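(* Let $r\in(0,1)$, $g_0\in SO(3)$, $\mathbf X_f\in S^2$. Suppose an optimal path of positive length for the free terminal orientation problem from $g_0$ to $\mathbf X_f$ satisfies the conditions of Pontryagin's Maximum Principle (as recalled in the context) with $\lambda=0$. Then it is of type $C_\alpha C_\pi C_\pi\cdots C_\pi$; that is, it is a concatenation of finitely many $C$ segments, consecutive segments being of opposite type ($L$ followed by $R$ or $R$ followed by $L$), in which the first segment has some arc angle $\alpha>0$ and all the subsequent segments (if any), including the last one, have arc angle exactly $\pi$.
   Context: Dubins vehicle on the unit sphere. Fix $r\in(0,1)$ and $U_{max}=\frac{\sqrt{1-r^2}}{r}$, so $r=\frac{1}{\sqrt{1+U_{max}^2}}$. A configuration is a rotation matrix $g=(\mathbf X\ \ \mathbf T\ \ \mathbf N)\in SO(3)$ with columns $\mathbf X$ (location on the unit sphere), $\mathbf T$ (heading) and $\mathbf N=\mathbf X\times\mathbf T$. An admissible path of length $L$ from $g_0$ is an absolutely continuous $g:[0,L]\to SO(3)$, $g(0)=g_0$, with $$\frac{dg}{ds}=\overrightarrow{l}_1(g(s))-u_g(s)\,\overrightarrow{L}_{12}(g(s)),\qquad u_g(s)\in[-U_{max},U_{max}]\ \text{measurable},$$ where $\overrightarrow l_1(g)=g\,l_1$ and $\overrightarrow L_{12}(g)=g\,L_{12}$ are left-invariant vector fields with $$l_1=\begin{pmatrix}0&-1&0\\1&0&0\\0&0&0\end{pmatrix},\qquad L_{12}=\begin{pmatrix}0&0&0\\0&0&1\\0&-1&0\end{pmatrix}.$$ Equivalently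 $\mathbf X'=\mathbf T$, $\mathbf T'=-\mathbf X+u_g\mathbf N$, $\mathbf N'=-u_g\mathbf T$. The free terminal orientation problem from $g_0$ to $\mathbf X_f$ is to minimize $L$ among admissible paths from $g_0$ with $\mathbf X(L)=\mathbf X_f$ ($\mathbf T(L),\mathbf N(L)$ unconstrained). Segments: $L$: $u_g\equiv U_{max}$; $R$: $u_g\equiv-U_{max}$; $C$ denotes $L$ or $R$. A $C$ segment of arc angle $\phi$ has length $r\phi$; subscripts denote arc angles. Pontryagin's Maximum Principle (PMP): for an optimal path $g$ with control $\kappa$ and length $L$ there are a constant $\lambda\in\{0,1\}$ and an absolutely continuous covector curve $\zeta(s)\in T^*_{g(s)}SO(3)$, with $(\lambda,\zeta(s))\ne(0,0)$, such that, writing $h_1(s)=\langle\zeta(s),\overrightarrow l_1(g(s))\rangle$, $H_{12}(s)=\langle\zeta(s),\overrightarrow L_{12}(g(s))\rangle$, $h_2(s)=\langle\zeta(s),\overrightarrow l_2(g(s))\rangle$ (with $\overrightarrow l_2$ the left-invariant field completing $\overrightarrow l_1,\overrightarrow L_{12}$ to a frame, with $l_2=\begin{pmatrix}0&0&-1\\0&0&0\\1&0&0\end{pmatrix}$), one has $$\dot h_1=-\kappa h_2,\qquad \dot h_2=H_{12}+\kappa h_1,\qquad \dot H_{12}=-h_2;$$ the Hamiltonian $H=-\lambda+h_1(s)-u\,H_{12}(s)$ is, for a.e. $s$, maximized over $u\in[-U_{max},U_{max}]$ at $u=\kappa(s)$, with maximal value $0$; and the transversality condition $\langle\zeta(L),v\rangle=0$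 holds for all $v\in T_{g(L)}S$, where $S=\{g\in SO(3): g e_1=\mathbf X_f\}$ and $e_1=(1,0,0)^T$. *)

(* Defs.v *)
From mathcomp Require Import all_boot all_order all_algebra.
From mathcomp Require Import all_classical all_reals all_analysis.

Set Implicit Arguments.
Unset Strict Implicit.
Unset Printing Implicit Defensive.

Import Order.TTheory GRing.Theory Num.Theory.
Import numFieldNormedType.Exports.

Local Open Scope classical_set_scope.
Local Open Scope ring_scope.

(** Functions of arc length are total functions on [R]; only their values on
    the interval named in each definition are ever constrained, and derivatives
    are only taken at interior points of that interval. *)

Definition absolutely_continuous (R : realType) (V : normedModType R)
    (a b : R) (f : R -> V) : Prop :=
  forall e : R, 0 < e -> exists2 d : R, 0 < d &
    forall (n : nat) (x y : 'I_n -> R),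
      (forall i, [/\ a <= x i, x i <= y i & y i <= b]) ->
      (forall i j, i != j -> y i <= x j \/ y j <= x i) ->
      \sum_i (y i - x i) < d ->
      \sum_i `|f (y i) - f (x i)| < e.

Section Rotations.
Variable R : realType.

Definition mx3 (rows : seq (seq R)) : 'M[R]_3 :=
  \matrix_(i, j) nth 0 (nth [::] rows i) j.

Definition l1 : 'M[R]_3 :=
  mx3 [:: [:: 0; -1; 0];
          [:: 1;  0; 0];
          [:: 0;  0; 0]].

Definition l2 : 'M[R]_3 :=
  mx3 [:: [:: 0; 0; -1];
          [:: 0; 0;  0];
          [:: 1; 0;  0]].

Definition L12 : 'M[R]_3 :=
  mx3 [:: [:: 0;  0; 0];
          [:: 0;  0; 1];
          [:: 0; -1; 0]].

Definition SO3 : set 'M[R]_3 := [set g | g^T *m g = 1%:M /\ \det g = 1].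

Definition sphere2 : set 'cV[R]_3 := [set X | \sum_i X i 0 ^+ 2 = 1].

(** The columns of a configuration are [X], [T] and [N], so [col 0 g] is
    [g e_1]. For [g] in [SO3] the relation [N = X x T] is automatic. *)
Definition location (g : 'M[R]_3) : 'cV[R]_3 := col 0 g.

Definition left_invariant (l g : 'M[R]_3) : 'M[R]_3 := g *m l.

(** Tangent vectors at [g] to a submanifold [S] of the space of matrices, as
    velocities of curves in [S] through [g]. *)
Definition tangent_space (S : set 'M[R]_3) (g : 'M[R]_3) : set 'M[R]_3 :=
  [set v | exists gamma : R -> 'M[R]_3,
     [/\ gamma 0 = g, (forall t, S (gamma t)) & is_derive (0 : R) 1 gamma v]].

(** Covectors at [g] are identified with elements of [tangent_space SO3 g]
    through the inner product [tr (A^T B)], whose restriction to that space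
    is nondegenerate. *)
Definition pairing (zeta v : 'M[R]_3) : R := \tr (zeta^T *m v).

End Rotations.

Arguments l1 {R}.
Arguments l2 {R}.
Arguments L12 {R}.
Arguments SO3 {R}.
Arguments sphere2 {R}.

Section Dubins.
Variables (R : realType) (r : R).

Definition Umax : R := Num.sqrt (1 - r ^+ 2) / r.

Definition dubins_trajectory (a b : R) (g : R -> 'M[R]_3) (u : R -> R) : Prop :=
  [/\ (forall s, s \in `[a, b] -> SO3 (g s)),
      absolutely_continuous a b g,
      measurable_fun `[a, b] u,
      (forall s, s \in `[a, b] -> - Umax <= u s <= Umax) &
      {ae @lebesgue_measure R, forall s, s \in `]a, b[ ->
         is_derive s 1 g
           (left_invariant l1 (g s) - u s *: left_invariant L12 (g s))}].

Definition admissible_path (g0 : 'M[R]_3) (L : R)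
    (g : R -> 'M[R]_3) (u : R -> R) : Prop :=
  [/\ 0 <= L, g 0 = g0 & dubins_trajectory 0 L g u].

Definition optimal_path (g0 : 'M[R]_3) (Xf : 'cV[R]_3) (L : R)
    (g : R -> 'M[R]_3) (u : R -> R) : Prop :=
  [/\ admissible_path g0 L g u,
      location (g L) = Xf &
      forall L' g' u', admissible_path g0 L' g' u' ->
        location (g' L') = Xf -> L <= L'].

Definition terminal_set (Xf : 'cV[R]_3) : set 'M[R]_3 :=
  [set g | SO3 g /\ location g = Xf].

Definition momentum (l : 'M[R]_3) (g zeta : R -> 'M[R]_3) (s : R) : R :=
  pairing (zeta s) (left_invariant l (g s)).

Definition hamiltonian (lambda : R) (g zeta : R -> 'M[R]_3) (s u : R) : R :=
  - lambda + momentum l1 g zeta s - u * momentum L12 g zeta s.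

(** The adjoint equations use the sign convention [dh2 = H12 + kappa h1]. Since
    [l1 *m L12 - L12 *m l1 = l2], the opposite sign of [h2] is also met; the two
    are exchanged by [h2 -> - h2]. *)
Definition pmp (Xf : 'cV[R]_3) (L : R) (g : R -> 'M[R]_3) (kappa : R -> R)
    (lambda : R) (zeta : R -> 'M[R]_3) : Prop :=
  let h1 := momentum l1 g zeta in
  let h2 := momentum l2 g zeta in
  let H12 := momentum L12 g zeta in
  (lambda = 0 \/ lambda = 1) /\
  [/\ absolutely_continuous 0 L zeta,
      (forall s, s \in `[0, L] -> tangent_space SO3 (g s) (zeta s)),
      (forall s, s \in `[0, L] -> ~ (lambda = 0 /\ zeta s = 0)) &
      {ae @lebesgue_measure R, forall s, s \in `]0, L[ ->
         [/\ is_derive s 1 h1 (- kappa s * h2 s),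
             is_derive s 1 h2 (H12 s + kappa s * h1 s) &
             is_derive s 1 H12 (- h2 s)]}] /\
  [/\ {ae @lebesgue_measure R, forall s, s \in `]0, L[ ->
         hamiltonian lambda g zeta s (kappa s) = 0 /\
         (forall u, - Umax <= u <= Umax ->
            hamiltonian lambda g zeta s u
              <= hamiltonian lambda g zeta s (kappa s))} &
      forall v, tangent_space (terminal_set Xf) (g L) v ->
        pairing (zeta L) v = 0].

(** [true] stands for a segment [L], [false] for a segment [R]. *)
Definition turn := bool.

Definition turn_control (c : turn) : R := if c then Umax else - Umax.

Definition C_segment (c : turn) (phi a : R) (g : R -> 'M[R]_3) : Prop :=
  0 < phi /\ dubins_trajectory a (a + r * phi) g (fun=> turn_control c).

(** [concatenation w a b g]: on [[a, b]], [g] is the concatenation of the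
    segments listed in [w] as pairs (type, arc angle). *)
Fixpoint concatenation (w : seq (turn * R)) (a b : R) (g : R -> 'M[R]_3) :
    Prop :=
  if w is (c, phi) :: w' then
    C_segment c phi a g /\ concatenation w' (a + r * phi) b g
  else a = b.

Definition type_CCpi (L : R) (g : R -> 'M[R]_3) : Prop :=
  exists (c : turn) (alpha : R) (w : seq (turn * R)),
    [/\ 0 < alpha,
        path (fun x y => x.1 != y.1) (c, alpha) w,
        all (fun x => x.2 == pi) w &
        concatenation ((c, alpha) :: w) 0 L g].

End Dubins.

(* Main.v *)
(** For [lambda = 0] the maximum condition reads [h1 = kappa H12 = - Umax |H12|],
    so that [kappa h1 = Umax^2 H12] and the pair [(H12, h2)] solves the harmonic
    oscillator [H12' = - h2], [h2' = H12 / r^2] almost everywhere. Transversality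
    gives [H12 L = 0]; hence [H12 s = r h2(L) sin ((L - s) / r)], and [h2(L)] is
    nonzero because otherwise [zeta L] would vanish. The control is therefore
    [- Umax] times the sign of this sine, and it switches exactly at the times
    at distance [k r pi] from the end point [L]. Solving the oscillator almost
    everywhere rests on the fact that an absolutely continuous function with
    derivative [0] almost everywhere is constant. *)
Require Import Defs.
From mathcomp Require Import all_boot all_order all_algebra.
From mathcomp Require Import all_classical all_reals all_analysis.
From mathcomp Require Import ring lra.

Set Implicit Arguments.
Unset Strict Implicit.
Unset Printing Implicit Defensive.

Import Order.TTheory GRing.Theory Num.Theory.
Import numFieldNormedType.Exports.
Local Open Scope ring_scope.

(** * Absolutely continuous functions with zero derivative almost everywhere *)

Lemma is_derive0_small (R : realType) (f : R -> R) (s e : R) :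
  is_derive s 1 f 0 -> 0 < e ->
  exists2 d : R, 0 < d & forall y, `|y - s| < d -> `|f y - f s| <= e * `|y - s|.
Proof.
move=> [df D0] e0.
have : (h^-1 *: (f (h + s) - f s) @[h --> 0^'] --> (0 : R))%classic.
  have -> : (fun h : R => h^-1 *: (f (h + s) - f s)) =
      (fun h : R => h^-1 *: ((f \o shift s) (h *: 1) - f s)).
    by apply/funext => h /=; rewrite [h *: 1]mulr1.
  by rewrite -[X in (_ --> X)%classic]D0; exact: df.
move=> /cvgrPdist_le /(_ e e0)/nbhs_ballP[d /= d0 dP].
exists d => // y yd.
have [->|ys] := eqVneq y s; first by rewrite !subrr normr0 mulr0.
have := dP (y - s); rewrite /ball_/ball/= sub0r normrN => /(_ yd).
rewrite subr_eq0 => /(_ ys); rewrite subrK sub0r normrN normrZ normfV.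
by rewrite mulrC ler_pdivrMr// normr_gt0 subr_eq0.
Qed.

Section constancy.
Context {R : realType}.
Notation mu := (@lebesgue_measure R).

(* [V] stands for an open set of small measure around the points where [f] is not
   known to have derivative [0]; the intervals [[x i, y i]] are those that a
   sweep from [a] to [t] crosses inside [V]. *)
Definition increment_cover (V : set R) (f : R -> R) (a e t : R) :=
  exists (n : nat) (x y : nat -> R),
    [/\ forall i, (i < n)%N -> [/\ a <= x i, x i <= y i & y i <= t],
        forall i j, (i < j < n)%N -> y i <= x j,
        ((\sum_(i < n) (y i - x i))%:E <= mu (V `&` `[a, t]%classic))%E &
        `|f t - f a| <= e * (t - a) + \sum_(i < n) `|f (y i) - f (x i)|].

(** The sweep moves on without a new interval: the increment over [[p, q]] is paid for by the slope
    term [e * (q - p)]. *)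
Lemma increment_cover_flat (V : set R) (f : R -> R) (a e p q : R) :
  measurable V -> p <= q ->
  `|f q - f p| <= e * (q - p) ->
  increment_cover V f a e p -> increment_cover V f a e q.
Proof.
move=> mO pq fpq [n [x [y [xy ord len inc]]]]; exists n, x, y; split => //.
- by move=> i /xy[? ? ?]; split => //; exact: le_trans pq.
- apply: le_trans len _; apply: le_measure; rewrite ?inE.
  + exact: measurableI.
  + exact: measurableI.
  + by apply: setIS => z /=; rewrite !in_itv/= => /andP[-> /= /le_trans]; apply.
- rewrite (le_trans (ler_distD (f p) _ _))//.
  rewrite (le_trans (lerD fpq inc))// addrA -mulrDr.
  by rewrite addrA subrK.
Qed.

(** The sweep moves on by recording [[p, q]] as the interval of index [n]: its increment joins the
    sum, and its length is paid for by the measure of [V]. *)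
Lemma increment_cover_open (V : set R) (f : R -> R) (a e p q : R) :
  measurable V -> 0 <= e -> a <= p -> p <= q ->
  (`[p, q]%classic `<=` V)%classic ->
  increment_cover V f a e p -> increment_cover V f a e q.
Proof.
move=> mO e0 ap pq pqV [n [x [y [xy ord len inc]]]].
exists n.+1, (fun i => if i == n then p else x i), (fun i => if i == n then q else y i).
have sumE (F : R -> R -> R) :
    \sum_(i < n.+1) F (if i == n :> nat then q else y i)
                      (if i == n :> nat then p else x i)
    = \sum_(i < n) F (y i) (x i) + F q p.
  rewrite big_ord_recr/= eqxx; congr (_ + _); apply: eq_bigr => i _.
  by rewrite (ltn_eqF (ltn_ord i)).
split.
- move=> i; rewrite ltnS leq_eqVlt; case: eqVneq => [_ _|_ /= /xy[? ? yp]]; split => //.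
  exact: le_trans pq.
- move=> i j /andP[ij]; rewrite ltnS leq_eqVlt; case: (eqVneq j n) => [jn _|_ /= jn].
    by subst j; rewrite (ltn_eqF ij); case: (xy _ ij).
  by rewrite (ltn_eqF (ltn_trans ij jn)); apply: ord; rewrite ij.
- rewrite (sumE (fun u v => u - v)) EFinD.
  (* Left open at [p], the new interval is disjoint from [[a, p]], so that the two measures add
     up. *)
  have -> : (q - p)%:E = mu `]p, q]%classic.
    by rewrite lebesgue_measure_itv/= lte_fin; case: ltgtP pq => // -> _; rewrite subrr.
  rewrite (le_trans (leeD2r _ len))// -measureU; last first.
  + rewrite -subset0 => z /= [[_]]; rewrite !in_itv/= => /andP[_ zp] /andP[pz _].
    by have := le_lt_trans zp pz; rewrite ltxx.
  + exact: measurable_itv.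
  + exact: measurableI.
  apply: le_measure; rewrite ?inE.
  + by apply: measurableU; [exact: measurableI|exact: measurable_itv].
  + exact: measurableI.
  + move=> z /= [[Oz]|]; rewrite !in_itv/= => /andP[z1 z2].
      by split => //; rewrite z1 (le_trans z2 pq).
    split; first by apply: pqV; rewrite /= in_itv/= (ltW z1).
    by rewrite z2 (le_trans ap (ltW z1)).
- rewrite (sumE (fun u v => `|f u - f v|)).
  rewrite (le_trans (ler_distD (f p) _ _))// addrC addrA lerD2r (le_trans inc)// lerD2r.
  by rewrite ler_wpM2l// lerD2r.
Qed.

(* Cousin's lemma, run on the supremum of the points that can be reached. *)
Lemma ac_derive0_const (a b : R) (f : R -> R) :
  a <= b -> absolutely_continuous a b f ->
  {ae mu, forall s, s \in `]a, b[ -> is_derive s 1 f 0} -> f a = f b.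
Proof.
move=> ab acf [A [mA A0 NA]].
(* The part [e * (b - a)] will come from the points of derivative zero, and the remaining [e] from
   absolute continuity on the intervals inside [V]. *)
suff H : forall e, 0 < e -> `|f b - f a| <= e * (b - a + 1).
  apply/eqP; rewrite eq_sym -subr_eq0 -normr_eq0 eq_le normr_ge0 andbT.
  have ba : 0 < b - a + 1 by rewrite ltr_wpDl// subr_ge0.
  apply/ler_addgt0Pl => e e0; rewrite addr0.
  by have := H (e / (b - a + 1)); rewrite divr_gt0// divfK ?gt_eqF//; apply.
move=> e e0.
have [d d0 acfd] := acf _ e0.
(* The derivative is known only inside the open interval, so the end points join the exceptional
   null set. *)
pose B := (A `|` [set a; b])%classic.
have mB : measurable B by apply: measurableU => //; exact: measurableU.
have B0 : mu B = 0%E.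
  apply/eqP; rewrite eq_le measure_ge0 andbT.
  rewrite (le_trans (measureU2 _ _ _))//; first exact: measurableU.
  rewrite [X in (X + _)%E]A0 add0e (le_trans (measureU2 _ _ _))//.
  by rewrite /= !lebesgue_measure_set1 adde0.
have [V [oO BO muO]] := lebesgue_regularity_outer (D := B) (eps := d) mB
  (eq_ind_r (fun z => (z < +oo)%E) (ltry 0) B0) d0.
have mO : measurable V by exact: measurable_realfun.open_measurable.
have muO' : (mu V < d%:E)%E.
  rewrite -(setDUK BO) measureU//; last by rewrite setDIK.
    by rewrite [X in (X + _)%E]B0 add0e.
  exact: measurableD.
pose S := [set t | a <= t <= b /\ increment_cover V f a e t]%classic.
have Sa : S a.
  split; first by rewrite lexx.
  exists 0%N, (fun=> 0), (fun=> 0); split => //.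
    by rewrite big_ord0 measure_ge0.
  by rewrite big_ord0 !subrr normr0 mulr0 addr0.
have supS : has_sup S.
  by split; [exists a|exists b => t [/andP[]]].
have Sb : S b.
  pose c := sup S.
  have leSc t : S t -> t <= c by apply: ub_le_sup; case: supS.
  have ac : a <= c by exact: leSc.
  have cb : c <= b by apply: ge_sup; [case: supS|move=> t [/andP[]]].
  (* Near [c] the sweep passes from any [p] on its left to any [q] on its right: inside [V] if [c]
     lies in [V], and by the zero derivative at [c] otherwise. *)
  have [h h0 hP] : exists2 h : R, 0 < h & forall p q,
      a <= p -> p <= c -> c <= q -> c - h < p -> q < c + h ->
      increment_cover V f a e p -> increment_cover V f a e q.
    have [cO|cO] := pselect (V c).
      move: oO; rewrite openE => /(_ _ cO); rewrite /interior => /nbhs_ballP[h /= h0 hO].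
      exists h => // p q ap pc cq hp qh; apply: increment_cover_open => //.
      - exact: ltW.
      - exact: le_trans cq.
      - move=> z /=; rewrite in_itv/= => /andP[pz zq]; apply: hO.
        by rewrite /ball/= ltr_distlC; apply/andP; split; lra.
    have dc : is_derive c 1 f 0.
      apply: contrapT => ndc; apply: cO; apply: BO.
      have [->|ca] := eqVneq c a; first by right; left.
      have [->|cb'] := eqVneq c b; first by right; right.
      left; apply: NA => /= H; apply: ndc; apply: H.
      by rewrite in_itv/= !lt_neqAle ac cb cb' eq_sym ca.
    have [h h0 hP] := @is_derive0_small R f c e dc e0.
    exists h => // p q ap pc cq hp qh; apply: increment_cover_flat => //.
      exact: le_trans cq.
    have /hP : `|p - c| < h by rewrite ltr_distl; apply/andP; split; lra.
    have /hP : `|q - c| < h by rewrite ltr_distl; apply/andP; split; lra.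
    rewrite (ger0_norm (_ : 0 <= q - c)) ?subr_ge0//
      (ler0_norm (_ : p - c <= 0)) ?subr_le0//.
    move=> H1 H2; rewrite (le_trans (ler_distD (f c) _ _))//.
    rewrite (distrC (f c)) (le_trans (lerD H1 H2))// -mulrDr ler_wpM2l ?(ltW e0)//; lra.
  have [p [/andP[ap pb] Pp] hp] := sup_adherent h0 supS.
  have pc : p <= c by apply: leSc; split => //; apply/andP.
  (* This point is reached, hence is at most the supremum [c]; since [c + h / 2] exceeds [c], the
     minimum must be [b]. *)
  pose q := Num.min b (c + h / 2).
  have Sq : S q.
    split; first by rewrite /q ge_min lexx/= le_min ab /=; lra.
    apply: hP Pp => //.
    - by rewrite /q le_min cb /=; lra.
    - by rewrite /q gt_min; apply/orP; right; lra.
  have qc : q <= c by exact: leSc.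
  suff <- : q = b by [].
  by move: qc; rewrite /q; case: (leP b (c + h / 2)) => // _; lra.
(* The recorded intervals have total length at most the measure of [V], which is below [d], so their
   increments sum to less than [e]. *)
have [_ [n [x [y [xy ord len inc]]]]] := Sb.
apply: le_trans inc _; rewrite [leRHS]mulrDr mulr1 lerD2l; apply/ltW.
apply: (acfd n (fun i => x i) (fun i => y i)).
- by move=> i; exact: xy.
- move=> i j; case: (ltngtP i j) => [ij _|ji _|/val_inj ->]; last by rewrite eqxx.
    by left; apply: ord; rewrite ij/=.
  by right; apply: ord; rewrite ji/=.
- rewrite -lte_fin (le_lt_trans len)// (le_lt_trans _ muO')//.
  apply: le_measure; rewrite ?inE//. exact: measurableI.
Qed.

End constancy.

(** * Closure properties of absolute continuity *)

Section absolute_continuity.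
Context {R : realType}.

(** Common source of the closure properties below. Two dominating functions are allowed so that sums
    and products are covered; a single one is used by taking it twice. *)
Lemma ac_dominated (V W X : normedModType R) (a b k : R)
    (f : R -> V) (g : R -> W) (h : R -> X) :
  (forall x y, a <= x -> x <= y -> y <= b ->
    `|h y - h x| <= k * (`|f y - f x| + `|g y - g x|)) ->
  absolutely_continuous a b f -> absolutely_continuous a b g ->
  absolutely_continuous a b h.
Proof.
move=> H acf acg e e0.
pose m := `|k| + 1.
have m0 : 0 < m by rewrite ltr_wpDl.
have em0 : 0 < e / (m * 2) by rewrite divr_gt0 ?mulr_gt0.
have [d1 d10 P1] := acf _ em0; have [d2 d20 P2] := acg _ em0.
exists (Num.min d1 d2); first by rewrite lt_min d10.
move=> n x y xy dis; rewrite lt_min => /andP[s1 s2].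
have {}P1 := P1 n x y xy dis s1; have {}P2 := P2 n x y xy dis s2.
apply: (@le_lt_trans _ _
    (m * (\sum_i `|f (y i) - f (x i)| + \sum_i `|g (y i) - g (x i)|))).
  rewrite -big_split/= mulr_sumr; apply: ler_sum => i _.
  have [ax xyi yb] := xy i.
  rewrite (le_trans (H _ _ ax xyi yb))// ler_wpM2r ?addr_ge0//.
  by rewrite (le_trans (ler_norm k))// lerDl.
rewrite mulrC -ltr_pdivlMr// (lt_le_trans (ltrD P1 P2))//.
by rewrite invfM mulrA -splitr.
Qed.

Lemma ac_id (a b : R) : absolutely_continuous a b (fun x : R => x).
Proof.
move=> e e0; exists e => // n x y xy _.
rewrite [X in _ -> X < _](eq_bigr (fun i => y i - x i)) // => i _.
by rewrite ger0_norm// subr_ge0; case: (xy i).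
Qed.

Lemma ac_lipschitz (V : normedModType R) (a b k : R) (f : R -> V) :
  (forall x y, a <= x -> x <= y -> y <= b -> `|f y - f x| <= k * (y - x)) ->
  absolutely_continuous a b f.
Proof.
move=> H; apply: (ac_dominated (k := k / 2) _ (@ac_id a b) (@ac_id a b)).
move=> x y ax xy yb; rewrite ger0_norm ?subr_ge0//.
have -> : k / 2 * ((y - x) + (y - x)) = k * (y - x) by field.
exact: H.
Qed.

Lemma ac_cst (V : normedModType R) (a b : R) (v : V) :
  absolutely_continuous a b (fun=> v).
Proof. by apply: (@ac_lipschitz _ _ _ 0) => *; rewrite subrr normr0 mul0r. Qed.

Lemma ac_subitv (V : normedModType R) (a b a' b' : R) (f : R -> V) :
  a <= a' -> b' <= b ->
  absolutely_continuous a b f -> absolutely_continuous a' b' f.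
Proof.
move=> aa bb acf e /acf[d d0 P]; exists d => // n x y xy; apply: P => i.
have [? ? ?] := xy i; split => //; [exact: le_trans aa _|exact: le_trans bb].
Qed.

Lemma ac_unif (V : normedModType R) (a b e : R) (f : R -> V) :
  absolutely_continuous a b f -> 0 < e ->
  exists2 d, 0 < d & forall x y, a <= x -> x <= y -> y <= b -> y - x < d ->
    `|f y - f x| < e.
Proof.
move=> acf /acf[d d0 P]; exists d => // x y ax xy yb yxd.
have := P 1%N (fun=> x) (fun=> y); rewrite !big_ord1; apply => //.
by move=> i j; rewrite !ord1.
Qed.

(** A step of length at most [d / 2] changes [f] by less than 1, and a bounded number of such steps
    leads from [a] to any point of the interval. *)
Lemma ac_bounded (V : normedModType R) (a b : R) (f : R -> V) :
  absolutely_continuous a b f ->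
  exists M, forall x, a <= x <= b -> `|f x| <= M.
Proof.
move=> acf; have [d d0 P] := ac_unif acf ltr01.
have H n : forall x, a <= x <= b -> x - a <= n%:R * (d / 2) ->
    `|f x - f a| <= n%:R.
  elim: n => [|n IH] x /andP[ax xb].
    rewrite mul0r subr_le0 => xa; suff -> : x = a by rewrite subrr normr0.
    by apply/eqP; rewrite eq_le xa.
  rewrite -natr1 mulrDl mul1r => xn.
  (* One step back from [x], cut off at [a] so as to stay in the interval. *)
  pose y := Num.max a (x - d / 2).
  have yx : y <= x by rewrite /y ge_max ax/=; lra.
  have ay : a <= y by rewrite /y le_max lexx.
  rewrite (le_trans (ler_distD (f y) _ _))// addrC lerD//.
    apply: IH; first by rewrite ay (le_trans yx).
    rewrite /y; case: (leP a (x - d / 2)) => _; first lra.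
    by rewrite subrr mulr_ge0// ltW// divr_gt0.
  apply/ltW/P => //.
  have : x - d / 2 <= y by rewrite /y le_max lexx orbT.
  lra.
pose n := Num.truncn ((b - a) / (d / 2)).
exists (n.+1%:R + `|f a|) => x /andP[ax xb].
rewrite -[f x](subrK (f a)) (le_trans (ler_normD _ _))// lerD2r.
apply: H; first by rewrite ax.
rewrite -ler_pdivrMr ?divr_gt0//.
have : 0 <= (b - a) / (d / 2).
  by rewrite divr_ge0 ?subr_ge0 ?(le_trans ax)// ltW// divr_gt0.
move=> /truncn_itv/andP[_ /ltW]; apply: le_trans.
by rewrite ler_pM2r ?invr_gt0 ?divr_gt0// lerD2r.
Qed.

Lemma ac_add (a b : R) (f g : R -> R) :
  absolutely_continuous a b f -> absolutely_continuous a b g ->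
  absolutely_continuous a b (fun x => f x + g x).
Proof.
move=> acf acg; apply: (ac_dominated (k := 1) _ acf acg) => x y _ _ _.
rewrite mul1r.
by rewrite opprD addrACA ler_normD.
Qed.

Lemma ac_mul (a b : R) (f g : R -> R) :
  absolutely_continuous a b f -> absolutely_continuous a b g ->
  absolutely_continuous a b (fun x => f x * g x).
Proof.
move=> acf acg; have [M1 H1] := ac_bounded acf; have [M2 H2] := ac_bounded acg.
apply: (ac_dominated (k := `|M1| + `|M2|) _ acf acg) => x y ax xy yb.
have -> : f y * g y - f x * g x = f y * (g y - g x) + g x * (f y - f x) by ring.
rewrite (le_trans (ler_normD _ _))// !normrM mulrDr addrC.
have H1y : `|f y| <= `|M1| + `|M2|.
  by rewrite (le_trans (H1 y _)) ?yb ?(le_trans ax xy)// (le_trans (ler_norm _))// lerDl.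
have H2x : `|g x| <= `|M1| + `|M2|.
  by rewrite (le_trans (H2 x _)) ?ax ?(le_trans xy yb)// (le_trans (ler_norm _))// lerDr.
by rewrite lerD// ler_wpM2r.
Qed.

Lemma ac_sum (a b : R) (I : finType) (F : I -> R -> R) :
  (forall i, absolutely_continuous a b (F i)) ->
  absolutely_continuous a b (fun x => \sum_i F i x).
Proof.
move=> H; elim: (index_enum I) => [|i s IH].
  by under eq_fun do rewrite big_nil; exact: ac_cst.
by under eq_fun do rewrite big_cons; exact: (ac_add (H i) IH).
Qed.

Lemma ac_mx_entry (a b : R) (m n : nat) (f : R -> 'M[R]_(m.+1, n.+1)) i j :
  absolutely_continuous a b f -> absolutely_continuous a b (fun x => f x i j).
Proof.
move=> acf; apply: (ac_dominated (k := 1) _ acf acf) => x y _ _ _.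
rewrite mul1r ler_wpDr// /Num.norm/= mx_normrE.
have := le_bigmax 0 (fun ij => `|(f y - f x) ij.1 ij.2|) (i, j).
by rewrite /= !mxE.
Qed.

(** A momentum is a polynomial in the entries of [g] and [zeta]. *)
Lemma ac_momentum (l : 'M[R]_3) (a b : R) (g zeta : R -> 'M[R]_3) :
  absolutely_continuous a b g -> absolutely_continuous a b zeta ->
  absolutely_continuous a b (momentum l g zeta).
Proof.
move=> acg acz.
have -> : momentum l g zeta =
    (fun s => \sum_i \sum_j zeta s j i * \sum_k g s j k * l k i).
  apply/funext => s; apply: eq_bigr => i _; rewrite mxE.
  by apply: eq_bigr => j _; rewrite !mxE.
apply: ac_sum => i; apply: ac_sum => j.
apply: ac_mul; first exact: (ac_mx_entry _ _ acz).
apply: ac_sum => k; apply: ac_mul; last exact: ac_cst.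
exact: (ac_mx_entry _ _ acg).
Qed.

End absolute_continuity.

(** * Tangent vectors and covectors on the rotation group *)

Section rotations.
Context {R : realType}.

Lemma is_derive_mx (m n : nat) (M : R -> 'M[R]_(m.+1, n.+1)) (x : R)
    (D : 'M[R]_(m.+1, n.+1)) :
  is_derive x 1 M D <-> (forall i j, is_derive x 1 (fun t => M t i j) (D i j)).
Proof.
split=> [[dM DM] i j|H].
  split; first by have /derivable_mxP := dM; exact.
  by rewrite -DM derive_mx// mxE.
have dM : derivable M x 1 by apply/derivable_mxP => i j; case: (H i j).
split => //; rewrite derive_mx//; apply/matrixP => i j; rewrite mxE.
by case: (H i j).
Qed.

Lemma SO3_orthogonal (g : 'M[R]_3) : SO3 g -> g *m g^T = 1%:M.
Proof. by move=> [/mulmx1C]. Qed.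

(** Obtained by differentiating the entries of [gamma^T *m gamma], which are constant along a curve
    of rotations. *)
Lemma tangent_SO3 (g v : 'M[R]_3) :
  tangent_space SO3 g v -> g^T *m v = - (v^T *m g).
Proof.
move=> [gamma [g0 so /is_derive_mx dg]].
apply/eqP; rewrite -addr_eq0; apply/eqP/matrixP => i j.
pose F := fun t => \sum_k gamma t k i * gamma t k j.
have FE t : F t = (i == j)%:R.
  have [/matrixP/(_ i j) + _] := so t; rewrite !mxE => <-.
  by apply: eq_bigr => k _; rewrite mxE.
have dF : is_derive (0 : R) 1 F (\sum_k (g k i * v k j + g k j * v k i)).
  rewrite -g0 /F.
  have -> : (fun t => \sum_k gamma t k i * gamma t k j) =
     \sum_k ((fun t => gamma t k i) * (fun t => gamma t k j)).
    by apply/funext => t; rewrite fct_sumE.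
  apply: is_derive_sum => k.
  exact: is_deriveM.
have := @derive_val _ _ _ _ _ _ _ dF.
rewrite (_ : F = cst (i == j)%:R); last exact/funext.
rewrite derive_cst !mxE => E; rewrite [RHS]E -big_split/=; apply: eq_bigr => k _.
by rewrite !mxE [v k i * _]mulrC.
Qed.

Lemma mx3E (s : seq (seq R)) i j : mx3 s i j = nth 0 (nth [::] s i) j.
Proof. by rewrite mxE. Qed.

Lemma sum3 (F : 'I_3 -> R) : \sum_i F i = F 0 + F 1 + F 2%:R.
Proof.
rewrite !big_ord_recl big_ord0 addr0 addrA.
by do ![congr (_ + _)|congr F]; exact: val_inj.
Qed.

(** The matrix [W = z^T *m g] is skew-symmetric, and the three pairings are [2 W01], [2 W02] and
    [- 2 W12]; hence [W] vanishes, and so does [z] because [g] is invertible. This turns vanishing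
    momenta into a violation of the nontriviality of the covector. *)
Lemma momenta_eq0 (g z : 'M[R]_3) : SO3 g -> tangent_space SO3 g z ->
  pairing z (left_invariant l1 g) = 0 ->
  pairing z (left_invariant l2 g) = 0 ->
  pairing z (left_invariant L12 g) = 0 -> z = 0.
Proof.
move=> sg /tangent_SO3 gz.
rewrite /pairing /left_invariant !mulmxA.
set W := z^T *m g in gz *.
have skew i j : W i j = - W j i.
  have /matrixP/(_ j i) := gz.
  have -> : g^T *m z = W^T by rewrite /W trmx_mul trmxK.
  by rewrite !mxE => ->.
have diag i : W i i = 0 by have := skew i i; lra.
rewrite /mxtrace !sum3 !mxE !sum3 !mx3E /=.
have := skew 0 1; have := skew 0 2%:R; have := skew 1 2%:R.
move=> e12 e02 e01 E1 E2 E3.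
have W0 : W = 0.
  have ord3 (i : 'I_3) : [\/ i = 0, i = 1 | i = 2%:R].
    by case: i => [[|[|[|//]]] ?];
      [constructor 1|constructor 2|constructor 3]; exact: val_inj.
  apply/matrixP => i j; rewrite [RHS]mxE.
  by case: (ord3 i) => ->; case: (ord3 j) => ->; rewrite ?diag //; lra.
apply: trmx_inj; rewrite trmx0 -[z^T]mulmx1 -(SO3_orthogonal sg) mulmxA.
by rewrite -/W W0 mul0mx.
Qed.

Lemma is_derive_cos_sin (a b x : R) :
  is_derive x 1 (fun t => a * cos t + b * sin t) (b * cos x - a * sin x).
Proof.
have -> : (fun t => a * cos t + b * sin t) = (a *: cos + b *: sin) :> (R -> R).
  by apply/funext.
apply: is_derive_eq; rewrite /GRing.scale/=; ring.
Qed.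

(** Turning the heading while the location stays fixed is right multiplication by [rot t], the
    exponential of [t *: L12]; its velocity at [t = 0] is the required vector. *)
Lemma tangent_terminal_set (g : 'M[R]_3) : SO3 g ->
  tangent_space (terminal_set (location g)) g (left_invariant L12 g).
Proof.
move=> sg.
pose rot (t : R) := mx3 [:: [:: 1; 0; 0]; [:: 0; cos t; sin t]; [:: 0; - sin t; cos t]].
exists (fun t => g *m rot t); split.
- have -> : rot 0 = 1%:M; last by rewrite mulmx1.
  apply/matrixP => i j; rewrite !mxE cos0 sin0 oppr0.
  by case: i => [[|[|[|//]]] ?]; case: j => [[|[|[|//]]] ?].
- move=> t; split; last first.
    apply/matrixP => i j; rewrite !mxE sum3 !mxE/=; ring.
  have [gg detg] := sg; split.
    rewrite trmx_mul -mulmxA (mulmxA g^T) gg mul1mx.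
    apply/matrixP => i j; rewrite !mxE sum3 !mxE.
    have := cos2Dsin2 t.
    by case: i => [[|[|[|//]]] ?]; case: j => [[|[|[|//]]] ?] /=; lra.
  rewrite det_mulmx detg mul1r (expand_det_row _ 0) sum3 !mxE/=.
  rewrite !mul0r !addr0 mul1r /cofactor expr0 mul1r.
  rewrite (expand_det_row _ 0) big_ord_recl big_ord1 !mxE /cofactor !det_mx11 !mxE /=.
  by rewrite /bump/= expr0 expr1 mul1r mulN1r opprK -!expr2 cos2Dsin2.
- apply/is_derive_mx => i j.
  have E t :
      (g *m rot t) i j = g i 0 * rot t 0 j + g i 1 * rot t 1 j + g i 2%:R * rot t 2%:R j.
    by rewrite mxE sum3.
  under eq_fun do rewrite E !mxE.
  rewrite mxE sum3 !mxE {E}.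
  have D (a b : R) := is_derive_cos_sin a b 0; rewrite cos0 sin0 in D.
  case: j => [[|[|[|//]]] ?] /=.
  + by apply: is_derive_eq; ring.
  + have -> : (fun x => g i 0 * 0 + g i 1 * cos x + g i 2%:R * - sin x) =
       (fun x => g i 1 * cos x + (- g i 2%:R) * sin x).
      by apply/funext => x; ring.
    by apply: is_derive_eq (D _ _) _; ring.
  + have -> : (fun x => g i 0 * 0 + g i 1 * sin x + g i 2%:R * cos x) =
       (fun x => g i 2%:R * cos x + g i 1 * sin x).
      by apply/funext => x; ring.
    by apply: is_derive_eq (D _ _) _; ring.
Qed.

End rotations.

(** * The harmonic oscillator solved almost everywhere *)

Section oscillator.
Context {R : realType}.
Notation mu := (@lebesgue_measure R).

Lemma ae_imply (P Q : R -> Prop) : (forall s, P s -> Q s) ->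
  {ae mu, forall s, P s} -> {ae mu, forall s, Q s}.
Proof. exact: (@filterS _ _ (ae_filter_ringOfSetsType mu)). Qed.

Lemma ae_and (P Q : R -> Prop) :
  {ae mu, forall s, P s} -> {ae mu, forall s, Q s} -> {ae mu, forall s, P s /\ Q s}.
Proof. exact: (@filterI _ _ (ae_filter_ringOfSetsType mu)). Qed.

(** Otherwise an interval of positive length would lie in a null set. *)
Lemma ae_itv_ex (a b : R) (P : R -> Prop) : a < b ->
  {ae mu, forall s, s \in `]a, b[ -> P s} -> exists2 s, s \in `]a, b[ & P s.
Proof.
move=> ab [A [mA A0 PA]]; apply: contrapT => nP.
have sub : (`]a, b[%classic `<=` A)%classic.
  by move=> s /= sab; apply: PA => /= H; apply: nP; exists s => //; exact: H.
have /= := le_measure mu (mem_set (measurable_itv `]a, b[)) (mem_set mA) sub.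
rewrite A0 lebesgue_measure_itv/= lte_fin ab -EFinB lee_fin subr_le0.
by rewrite leNgt ab.
Qed.

Lemma sinD_natpi (x : R) k : sin (x + k%:R * pi) = (-1) ^+ k * sin x.
Proof.
elim: k => [|k IH]; first by rewrite mul0r addr0 expr0 mul1r.
by rewrite -natr1 mulrDl mul1r addrA sinDpi IH exprS -mulrA mulN1r.
Qed.

Lemma ac_bounded_derive (a b k : R) (f df : R -> R) :
  (forall x : R, is_derive x 1 f (df x)) -> (forall x, `|df x| <= k) ->
  absolutely_continuous a b f.
Proof.
move=> dfE dfk; apply: (ac_lipschitz (k := k)) => x y _ xy _.
have [z _ ->] := MVT_segment xy (fun z _ => dfE z)
  (derivable_within_continuous (fun z _ => @ex_derive _ _ _ _ _ _ _ (dfE z))).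
by rewrite normrM (ger0_norm (_ : 0 <= y - x)) ?ler_wpM2r ?subr_ge0.
Qed.

Lemma is_derive_affine (w L x : R) : is_derive x 1 (fun s : R => w * (L - s)) (- w).
Proof.
have -> : (fun s => w * (L - s)) = w *: (cst L - id) :> (R -> R) by exact/funext.
by apply: is_derive_eq; rewrite sub0r scalerN -[w *: 1]/(w * 1) mulr1.
Qed.

Lemma is_derive_cos_affine (w L x : R) :
  is_derive x 1 (fun s : R => cos (w * (L - s))) (w * sin (w * (L - x))).
Proof.
have := @is_derive1_comp _ cos (fun s : R => w * (L - s)) _ _ _
  (is_derive_cos (w * (L - x))) (is_derive_affine w L x).
by rewrite mulrNN mulrC.
Qed.

Lemma is_derive_sin_affine (w L x : R) :
  is_derive x 1 (fun s : R => sin (w * (L - s))) (- w * cos (w * (L - x))).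
Proof.
have := @is_derive1_comp _ sin (fun s : R => w * (L - s)) _ _ _
  (is_derive_sin (w * (L - x))) (is_derive_affine w L x).
by rewrite mulrC.
Qed.

Lemma ac_cos_affine (w c a b : R) :
  absolutely_continuous a b (fun s => cos (w * (c - s))).
Proof.
apply: (@ac_bounded_derive _ _ `|w| _ _ (is_derive_cos_affine w c)) => x.
by rewrite normrM ler_piMr// ler_norml sin_geN1 sin_le1.
Qed.

Lemma ac_sin_affine (w c a b : R) :
  absolutely_continuous a b (fun s => sin (w * (c - s))).
Proof.
apply: (@ac_bounded_derive _ _ `|w| _ _ (is_derive_sin_affine w c)) => x.
by rewrite normrM normrN ler_piMr// ler_norml cos_geN1 cos_le1.
Qed.

(** Rotating the vector [(w f, h)] by the phase [th] gives [(A, B)], whose derivative is zero almost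
    everywhere. Both components are thus constant, equal to their values [0] and [h L] at [L], where
    the phase vanishes; rotating back gives the formulas. *)
Lemma oscillator_solution (w L : R) (f h : R -> R) : w != 0 ->
  absolutely_continuous 0 L f -> absolutely_continuous 0 L h ->
  {ae mu, forall s, s \in `]0, L[ ->
     is_derive s 1 f (- h s) /\ is_derive s 1 h (w ^+ 2 * f s)} ->
  f L = 0 ->
  forall s, 0 <= s <= L ->
    w * f s = h L * sin (w * (L - s)) /\ h s = h L * cos (w * (L - s)).
Proof.
move=> w0 acf ach ode fL s /andP[s0 sL].
pose th (x : R) := w * (L - x).
pose A x := w * f x * cos (th x) + - h x * sin (th x).
pose B x := w * f x * sin (th x) + h x * cos (th x).
have acN : absolutely_continuous 0 L (fun x => - h x).
  have -> : (fun x => - h x) = (fun x => -1 * h x) by apply/funext => x; rewrite mulN1r.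
  by apply: ac_mul ach; exact: ac_cst.
have acw : absolutely_continuous 0 L (fun x => w * f x).
  by apply: ac_mul acf; exact: ac_cst.
have ode' : {ae mu, forall x, x \in `]s, L[ ->
    is_derive x 1 f (- h x) /\ is_derive x 1 h (w ^+ 2 * f x)}.
  move: ode; apply: ae_imply => x dx xs.
  by apply: dx; move: xs; rewrite !in_itv/= => /andP[/(le_lt_trans s0) -> ->].
have EA : A s = A L.
  apply: ac_derive0_const => //.
    apply: ac_subitv s0 (lexx L) _.
    by apply: ac_add; apply: ac_mul => //; [exact: ac_cos_affine|exact: ac_sin_affine].
  move: (ode'); apply: ae_imply => x dx /dx[df dh].
  have -> : A = (w *: f) * (fun x => cos (th x)) - h * (fun x => sin (th x)).
    by apply/funext => y; rewrite /A mulNr.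
  have dc : is_derive x 1 (fun x => cos (th x)) _ := is_derive_cos_affine w L x.
  have ds : is_derive x 1 (fun x => sin (th x)) _ := is_derive_sin_affine w L x.
  apply: is_derive_eq; rewrite -[(w *: f) x]/(w * f x) /GRing.scale/=/th; ring.
have EB : B s = B L.
  apply: ac_derive0_const => //.
    apply: ac_subitv s0 (lexx L) _.
    by apply: ac_add; apply: ac_mul => //; [exact: ac_sin_affine|exact: ac_cos_affine].
  move: (ode'); apply: ae_imply => x dx /dx[df dh].
  have -> : B = (w *: f) * (fun x => sin (th x)) + h * (fun x => cos (th x)).
    by apply/funext.
  have dc : is_derive x 1 (fun x => cos (th x)) _ := is_derive_cos_affine w L x.
  have ds : is_derive x 1 (fun x => sin (th x)) _ := is_derive_sin_affine w L x.
  apply: is_derive_eq; rewrite -[(w *: f) x]/(w * f x) /GRing.scale/=/th; ring.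
have cs := cos2Dsin2 (th s).
rewrite -/(th s).
have thL : th L = 0 by rewrite /th subrr mulr0.
have A0 : A s = 0 by rewrite EA /A thL fL mulr0 mul0r sin0 mulr0 addr0.
have B0 : B s = h L by rewrite EB /B thL fL mulr0 mul0r cos0 mulr1 add0r.
split.
  transitivity (B s * sin (th s) + A s * cos (th s)); last by rewrite A0 B0 mul0r addr0.
  rewrite -[LHS]mulr1 -cs /A /B; ring.
transitivity (B s * cos (th s) - A s * sin (th s)); last by rewrite A0 B0 mul0r subr0.
rewrite -[LHS]mulr1 -cs /A /B; ring.
Qed.

End oscillator.

(** * From the sign of the sine to a concatenation of segments *)

Section dubins.
Context {R : realType} (r : R).
Notation mu := (@lebesgue_measure R).

Lemma Umax_gt0 : 0 < r < 1 -> 0 < Umax r.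
Proof.
move=> /andP[r0 r1]; rewrite divr_gt0// sqrtr_gt0 subr_gt0.
by rewrite expr_lt1 // ltW.
Qed.

Lemma Umax_sq : 0 < r < 1 -> 1 + Umax r ^+ 2 = r^-1 ^+ 2.
Proof.
move=> /andP[r0 r1]; rewrite /Umax exprMn sqr_sqrtr; first by field; rewrite gt_eqF.
by rewrite subr_ge0 expr_le1 // ltW.
Qed.

(** The equation of motion is imposed only almost everywhere, so a control may be replaced by a
    constant with which it agrees almost everywhere. *)
Lemma dubins_trajectory_cst (L p q v : R) (g : R -> 'M[R]_3) (u : R -> R) :
  0 <= p -> q <= L -> - Umax r <= v <= Umax r ->
  dubins_trajectory r 0 L g u ->
  {ae mu, forall s, s \in `]p, q[ -> u s = v} ->
  dubins_trajectory r p q g (fun=> v).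
Proof.
move=> p0 qL vU [so acg _ _ dg] uv; split => //.
- move=> s; rewrite in_itv/= => /andP[ps sq]; apply: so.
  by rewrite in_itv/= (le_trans p0)// (le_trans sq).
- exact: ac_subitv acg.
- have := ae_and dg uv; apply: ae_imply => s [ds us] spq; rewrite -us//; apply: ds.
  by move: spq; rewrite !in_itv/= => /andP[/(le_lt_trans p0) -> /lt_le_trans ->].
Qed.

Lemma turn_control_bound (c : turn) : 0 <= Umax r ->
  - Umax r <= turn_control r c <= Umax r.
Proof. by move=> U0; case: c; rewrite /turn_control lexx ?andbT/= ge0_cp. Qed.

(** A linear function of the control with nonzero slope [- H] is maximal only at one end of the
    interval: [Umax] if [H < 0], [- Umax] if [H > 0]. *)
Lemma maximizing_control (H k : R) : 0 < Umax r -> - Umax r <= k <= Umax r ->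
  (forall u, - Umax r <= u <= Umax r -> - (u * H) <= - (k * H)) ->
  H != 0 -> k = turn_control r (H < 0).
Proof.
move=> U0 /andP[k1 k2] Hk; rewrite /turn_control neq_lt => /orP[H0|H0].
  rewrite H0; apply/eqP; rewrite eq_le k2/=.
  have := Hk (Umax r); rewrite lexx andbT ge0_cp ?(ltW U0)// => /(_ isT).
  by rewrite lerN2 ler_nM2r.
rewrite ltNge (ltW H0)/=; apply/eqP; rewrite eq_le k1 andbT.
have := Hk (- Umax r); rewrite lexx ge0_cp ?(ltW U0)// => /(_ isT).
by rewrite lerN2 ler_pM2r.
Qed.

(* Segments are numbered backwards from the end point. *)
Fixpoint half_turns (c : nat -> turn) (n : nat) : seq (turn * R) :=
  if n is m.+1 then (c m, pi) :: half_turns c m else [::].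

Lemma half_turns_pi c n : all (fun x : turn * R => x.2 == pi) (half_turns c n).
Proof. by elim: n => //= n ->; rewrite eqxx. Qed.

Lemma half_turns_path c n alpha : (forall k, c k.+1 != c k) ->
  path (fun x y : turn * R => x.1 != y.1) (c n, alpha) (half_turns c n).
Proof.
move=> alt; elim: n alpha => //= n IH alpha.
by rewrite alt IH.
Qed.

(** The hypothesis speaks of subintervals of the window of index [k], the one between the distances
    [k r pi] and [(k + 1) r pi] from [L]. Here each window is used in full; the subintervals also
    serve the first segment of a path, which may be shorter. *)
Lemma concatenation_half_turns (c : nat -> turn) (L : R) (g : R -> 'M[R]_3) n a :
  (forall k p q, 0 <= p -> p < q -> q <= L ->
     L - k.+1%:R * (r * pi) <= p -> q <= L - k%:R * (r * pi) ->
     dubins_trajectory r p q g (fun=> turn_control r (c k))) ->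
  0 < r -> 0 <= a -> a = L - n%:R * (r * pi) ->
  concatenation r (half_turns c n) a L g.
Proof.
move=> seg r0; have rpi : 0 < r * pi by rewrite mulr_gt0 ?pi_gt0.
elim: n a => [|n IH] a a0 aE /=; first by rewrite aE mul0r subr0.
have aE' : a + r * pi = L - n%:R * (r * pi) by rewrite aE -natr1; ring.
split; last by apply: IH => //; rewrite addr_ge0// ltW.
split; first exact: pi_gt0.
apply: seg => //.
- by rewrite ltrDl.
- by rewrite aE' gerBl mulr_ge0// ltW.
- by rewrite aE.
- by rewrite aE'.
Qed.

(** The strict inequality is on the left, unlike for truncation, so that the first arc keeps a
    positive angle even when [x] is an integer. *)
Lemma ex_nat_lt_le (x : R) : 0 < x -> exists n : nat, n%:R < x <= n.+1%:R.
Proof.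
move=> x0; have ex : exists n, (x <= n.+1%:R).
  by exists (Num.truncn x); have /andP[_ /ltW] := truncn_itv (ltW x0).
exists (ex_minn ex); case: ex_minnP => -[|n] -> min; rewrite andbT//.
by rewrite ltNge; apply/negP => /min; rewrite ltnn.
Qed.

Lemma bang_bang_type (L B : R) (g : R -> 'M[R]_3) (kappa : R -> R) :
  0 < r < 1 -> 0 < L -> B != 0 ->
  dubins_trajectory r 0 L g kappa ->
  {ae mu, forall s, s \in `]0, L[ -> B * sin (r^-1 * (L - s)) != 0 ->
     kappa s = turn_control r (B * sin (r^-1 * (L - s)) < 0)} ->
  type_CCpi r L g.
Proof.
move=> r01 L0 B0 traj ctl; have /andP[r0 r1] := r01.
have rpi : 0 < r * pi by rewrite mulr_gt0 ?pi_gt0.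
have [n /andP[nL Ln]] := @ex_nat_lt_le (L / (r * pi)) (divr_gt0 L0 rpi).
(* On the window of index [k] the sine has sign [(-1)^k]; the type is [L] exactly when its product
   with [B] is negative. *)
pose c k := (B < 0) (+) odd k.
have seg k p q : 0 <= p -> p < q -> q <= L ->
     L - k.+1%:R * (r * pi) <= p -> q <= L - k%:R * (r * pi) ->
     dubins_trajectory r p q g (fun=> turn_control r (c k)).
  move=> p0 pq qL pk kq; apply: (dubins_trajectory_cst p0 qL _ traj).
    by apply: turn_control_bound; rewrite ltW// Umax_gt0.
  move: ctl; apply: ae_imply => s; rewrite !in_itv/= => cs /andP[ps sq].
  (* The phase reduced to the open interval from [0] to [pi], where the sine is positive. *)
  pose y := r^-1 * (L - s) - k%:R * pi.
  have yE : r^-1 * (L - s) = y + k%:R * pi by rewrite /y subrK.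
  have siny : 0 < sin y.
    apply: sin_gt0_pi; rewrite -(ltr_pM2l r0) -[y < _](ltr_pM2l r0) mulr0.
    have -> : r * y = L - s - k%:R * (r * pi) by rewrite /y; field; rewrite gt_eqF.
    rewrite -natr1 in pk.
    by apply/andP; split; lra.
  have E : (B * sin (r^-1 * (L - s)) < 0) = c k.
    rewrite yE sinD_natpi mulrA pmulr_llt0// /c -signr_odd.
    case: (odd k); rewrite ?expr0 ?expr1 ?mulr1 ?mulrN1 ?addbF ?addbT//.
    by rewrite oppr_lt0 lt_neqAle eq_sym B0 /= leNgt.
  rewrite cs ?E//; first by rewrite (le_lt_trans p0)// (lt_le_trans sq).
  by rewrite yE sinD_natpi !mulf_neq0 ?signr_eq0// gt_eqF.
(* The angle left after [n] half turns; by the choice of [n] it lies in []0, pi]], so the first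
   segment fits into the window of index [n]. *)
pose alpha := L / r - n%:R * pi.
have ralpha : r * alpha = L - n%:R * (r * pi) by rewrite /alpha; field; rewrite gt_eqF.
have ralpha0 : 0 < r * alpha.
  by rewrite ralpha subr_gt0 -ltr_pdivlMr.
exists (c n), alpha, (half_turns c n); split.
- by rewrite -(pmulr_rgt0 _ r0).
- by apply: half_turns_path => k; rewrite /c/= addbN; case: (_ (+) _).
- exact: half_turns_pi.
- rewrite /= add0r; split.
    split; first by rewrite -(pmulr_rgt0 _ r0).
    rewrite add0r; apply: seg => //; rewrite ?ralpha//.
      by rewrite gerBl mulr_ge0// ltW.
    by rewrite subr_le0 -ler_pdivrMr.
  by apply: concatenation_half_turns => //; exact: ltW.
Qed.

End dubins.

(** * The maximum principle with zero multiplier *)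

Theorem proposition6 (R : realType) (r : R) (g0 : 'M[R]_3) (Xf : 'cV[R]_3)
    (L : R) (g : R -> 'M[R]_3) (kappa : R -> R) (zeta : R -> 'M[R]_3) :
  0 < r < 1 ->
  SO3 g0 ->
  sphere2 Xf ->
  0 < L ->
  optimal_path r g0 Xf L g kappa ->
  pmp r Xf L g kappa 0 zeta ->
  type_CCpi r L g.
Proof.
move=> r01 _ _ L0 [[_ _ traj] gL _] [_ [[acz tanz nz adj] [ham trans]]].
have [so acg _ kU _] := traj; have U0 := Umax_gt0 r01; have /andP[r0 _] := r01.
have rV0 : r^-1 != 0 by rewrite invr_eq0 gt_eqF.
set h1 := momentum l1 g zeta in adj ham *.
set h2 := momentum l2 g zeta in adj ham *.
set H := momentum L12 g zeta in adj ham *.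
have inL : L \in `[0, L] by rewrite in_itv/= lexx ltW.
have HL : H L = 0.
  by apply: trans; rewrite -gL; apply: tangent_terminal_set; exact: so.
have {ham} ham : {ae @lebesgue_measure R, forall s, s \in `]0, L[ ->
    h1 s = kappa s * H s /\ (H s != 0 -> kappa s = turn_control r (H s < 0))}.
  move: ham; apply: ae_imply => s hs s0L; have [E M] := hs s0L.
  split; first by move: E; rewrite /hamiltonian; lra.
  apply: maximizing_control => //.
    by apply: kU; move: s0L; rewrite !in_itv/= => /andP[/ltW -> /ltW ->].
  move=> u /M; rewrite /hamiltonian -/H; lra.
have ode : {ae @lebesgue_measure R, forall s, s \in `]0, L[ ->
    is_derive s 1 H (- h2 s) /\ is_derive s 1 h2 (r^-1 ^+ 2 * H s)}.
  have := ae_and adj ham; apply: ae_imply => s [adjs hams] s0L.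
  have [_ dh2 dH] := adjs s0L; have [E K] := hams s0L; split => //.
  apply: is_derive_eq dh2 _; rewrite E -(Umax_sq r01).
  (* Where [H] vanishes both sides are zero whatever the control; elsewhere the control is extremal
     and its square is [Umax ^+ 2]. *)
  have [->|/K ->] := eqVneq (H s) 0; first by rewrite !mulr0 addr0.
  by rewrite /turn_control; case: ifP => _; ring.
have sol := oscillator_solution rV0 (ac_momentum L12 acg acz)
  (ac_momentum l2 acg acz) ode HL.
apply: (@bang_bang_type _ _ _ (h2 L)) traj _ => //; last first.
  move: ham; apply: ae_imply => s hs s0L.
  have sL : 0 <= s <= L by move: s0L; rewrite in_itv/= => /andP[/ltW -> /ltW ->].
  have [<- _] := sol s sL; rewrite mulf_eq0 (negbTE rV0) pmulr_rlt0 ?invr_gt0//.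
  by have [_] := hs s0L.
apply/eqP => h2L.
(* If [h2 L = 0], then [H] and [h2] vanish on the whole interval. The relation [h1 = kappa H] holds
   only almost everywhere, perhaps not at [L]; it gives [h1 = 0] at some interior [s0], and this is
   carried to [L] because the derivative of [h1] is zero almost everywhere. *)
have [s0 s0L [E _]] := ae_itv_ex L0 ham.
have zero s : 0 <= s <= L -> H s = 0 /\ h2 s = 0.
  move=> /sol[] /[swap]; rewrite -/(h2 s) -/(h2 L) h2L !mul0r => -> /eqP.
  by rewrite mulf_eq0 (negbTE rV0) => /eqP.
have h1L : h1 L = 0.
  move: s0L; rewrite in_itv/= => /andP[s00 s0L].
  have <- : h1 s0 = h1 L.
    apply: ac_derive0_const; first exact: ltW.
      by apply: (ac_subitv (ltW s00) (lexx L)); exact: ac_momentum.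
    move: adj; apply: ae_imply => s adjs; rewrite in_itv/= => /andP[s0s sL].
    have [] := adjs; first by rewrite in_itv/= (lt_trans s00).
    move=> dh1 _ _.
    apply: is_derive_eq dh1 _; have [|_ h2s] := zero s.
      by rewrite (ltW (lt_trans s00 s0s)) ltW.
    by rewrite h2s mulr0.
  have [|Hs0 _] := zero s0; first by rewrite !ltW.
  by rewrite E Hs0 mulr0.
by case: (nz L inL); split => //; apply: (momenta_eq0 (so L inL) (tanz L inL)).
Qed.
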